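(* Let $Q_H:\mathbb{R}^{d_H}\to\mathbb{R}$ and $Q_L:\mathbb{R}^{d_L}\to\mathbb{R}$ be the high- and low-fidelity models, with truncation dimensions $1\le r_H\le d_H$, $1\le r_L\le d_L$, and let $\widehat{Q}^{MFAB}$ be the multifidelity adaptive-basis estimator defined in the context, viewed as an estimator of $\mathbb{E}[Q_H(\bm{\xi}_H)]$. Then its mean squared error is $$\mathrm{MSE}\big[\widehat{Q}^{MFAB}\big]=\mathrm{Var}\big[\widehat{Q}^{MFAB}\big]+\Big(\mathbb{E}\big[Q_H(\mathcal{A}_{H,r_H}^{T}\bm{\eta}_s)\big]-\mathbb{E}\big[Q_H(\bm{\xi}_H)\big]\Big)^2=\sigma^2(r_H,r_L)+\delta^2(r_H),$$ where $$\sigma^2(r_H,r_L)=\mathrm{Var}\big[\widehat{Q}_H^{r_H}\big]\left(1-\frac{\upsilon-1}{\upsilon}\,\rho^2_{r_L,r_H}\right),$$ $$\rho^2_{r_L,r_H}=\frac{\mathrm{Cov}^2\big[Q_H(\mathcal{A}_{H,r_H}^{T}\bm{\eta}_s),\,Q_L(\mathcal{A}_{L,r_L}^{T}\bm{\eta}_s)\big]}{\mathrm{Var}\big[Q_H(\mathcal{A}_{H,r_H}^{T}\bm{\eta}_s)\big]\,\mathrm{Var}\big[Q_L(\mathcal{A}_{L,r_L}^{T}\bm{\eta}_s)\big]},$$ and the squared bias of the estimator is $$\delta^2(r_H)=\Big(\mathbb{E}\big[Q_H(\mathcal{A}_{H,r_H}^{T}\bm{\eta}_s)\big]-\mathbb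{E}\big[Q_H(\bm{\xi}_H)\big]\Big)^2.$$
   Context: Inputs: $\bm{\xi}_H\in\mathbb{R}^{d_H}$ is a vector of independent standard Gaussian random variables. $\bm{A}_H\in\mathbb{R}^{d_H\times d_H}$ and $\bm{A}_L\in\mathbb{R}^{d_L\times d_L}$ are fixed (deterministic) matrices with $\bm{A}_H\bm{A}_H^T=\bm{I}$, $\bm{A}_L\bm{A}_L^T=\bm{I}$; $\bm{A}_{H,r_H}$ and $\bm{A}_{L,r_L}$ denote their first $r_H$, respectively $r_L$, rows. Put $r_s=\max(r_H,r_L)$ and $$\mathcal{A}_{H,r_H}^{T}=\big[\bm{A}_{H,r_H}^{T}\;\;\bm{0}_{d_H\times(r_s-r_H)}\big]\in\mathbb{R}^{d_H\times r_s},\qquad \mathcal{A}_{L,r_L}^{T}=\big[\bm{A}_{L,r_L}^{T}\;\;\bm{0}_{d_L\times(r_s-r_L)}\big]\in\mathbb{R}^{d_L\times r_s}.$$ The shared variable $\bm{\eta}_s$ is a standard Gaussian vector in $\mathbb{R}^{r_s}$. Sampling: let $N\ge1$ be an integer and $\upsilon>1$ a real number with $\upsilon N$ an integer. Let $\bm{\eta}_s^{(1)},\dots,\bm{\eta}_s^{(\upsilon N)}$ be i.i.d. copies of $\bm{\eta}_s$; the first $N$ are used for the high-fidelity model and for the first low-fidelity mean estimator, and all $\upsilon N$ are used for the second low-fidelity mean estimator: $$\widehat{Q}_H^{r_H}=\frac1N\sum_{i=1}^{N}Q_H\big(\mathcal{A}_{H,r_H}^T\bm{\eta}_s^{(i)}\big),\quad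 \widehat{Q}_L^{r_L}=\frac1N\sum_{i=1}^{N}Q_L\big(\mathcal{A}_{L,r_L}^T\bm{\eta}_s^{(i)}\big),\quad \widehat{\mu}_L^{r_L}=\frac1{\upsilon N}\sum_{i=1}^{\upsilon N}Q_L\big(\mathcal{A}_{L,r_L}^T\bm{\eta}_s^{(i)}\big).$$ The estimator is $\widehat{Q}^{MFAB}=\widehat{Q}_H^{r_H}+\alpha\,(\widehat{Q}_L^{r_L}-\widehat{\mu}_L^{r_L})$ with the deterministic variance-minimizing coefficient $$\alpha=-\rho\,\frac{\mathrm{Var}^{1/2}[Q_H(\mathcal{A}_{H,r_H}^T\bm{\eta}_s)]}{\mathrm{Var}^{1/2}[Q_L(\mathcal{A}_{L,r_L}^T\bm{\eta}_s)]},$$ where $\rho$ is the Pearson correlation coefficient of $Q_H(\mathcal{A}_{H,r_H}^T\bm{\eta}_s)$ and $Q_L(\mathcal{A}_{L,r_L}^T\bm{\eta}_s)$. It is assumed that $Q_H(\bm{\xi}_H)$ is integrable and that $Q_H(\mathcal{A}_{H,r_H}^T\bm{\eta}_s)$, $Q_L(\mathcal{A}_{L,r_L}^T\bm{\eta}_s)$ have finite, nonzero variances. The mean squared error is $\mathrm{MSE}[\widehat{Q}^{MFAB}]=\mathbb{E}\big[(\widehat{Q}^{MFAB}-\mathbb{E}[Q_H(\bm{\xi}_H)])^2\big]$. *)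

(* Defs.v *)
From mathcomp Require Import all_boot all_order all_algebra.
From mathcomp Require Import all_classical all_reals all_analysis.

Set Implicit Arguments.
Unset Strict Implicit.
Unset Printing Implicit Defensive.

Import Order.TTheory GRing.Theory Num.Theory.
Import numFieldNormedType.Exports.

Local Open Scope classical_set_scope.
Local Open Scope ring_scope.

(* R^n as column vectors, with its Borel sigma-algebra. *)
Notation borel_cV R n := (g_sigma_algebraType (@open 'cV[R]_n)).

Section probability.
Context d (T : measurableType d) (R : realType) (P : probability T R).

(* Mutual independence of a finite family of random elements: the product rule
   over every subfamily. *)
Definition mutually_independent (I : finType) d' (E : measurableType d')
    (X : I -> T -> E) : Prop :=
  forall (J : {set I}) (B : I -> set E), (forall i, measurable (B i)) ->
    P (\bigcap_(i in [set` J]) (X i @^-1` B i)) =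
    (\big[*%E/1%E]_(i in J) P (X i @^-1` B i))%E.

Definition identically_distributed d' (E : measurableType d')
    (X Y : {RV P >-> E}) : Prop :=
  forall B : set E, measurable B -> distribution P X B = distribution P Y B.

Definition standard_gaussian n (X : {RV P >-> borel_cV R n}) : Prop :=
  let coord (i : 'I_n) (w : T) : R := (X w : 'cV[R]_n) i ord0 in
  (forall i (B : set R), measurable B ->
     P (coord i @^-1` B) = normal_prob 0 1 B) /\
  mutually_independent coord.

Definition pearson_corr (X Y : T -> R) : R :=
  fine (covariance P X Y) /
    (Num.sqrt (fine 'V_P[X]%E) * Num.sqrt (fine 'V_P[Y]%E)).

Definition mse (theta_hat : T -> R) (theta : R) : \bar R :=
  ('E_P[(fun w => (theta_hat w - theta) ^+ 2)%R])%E.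

End probability.

(* The d x s matrix [A_r^T 0], where A_r consists of the first r rows of A. *)
Definition truncated_basis (R : realType) d r s (r_le_d : (r <= d)%N)
    (r_le_s : (r <= s)%N) (A : 'M[R]_d) : 'M[R]_(d, s) :=
  castmx (erefl d, subnKC r_le_s)
    (row_mx (rowsub (widen_ord r_le_d) A)^T (0 : 'M[R]_(d, s - r))).

(* The average of the first k members of a family of M real functions
   (meaningful for 0 < k <= M). *)
Definition mean_first (T : Type) (R : realType) M (Y : 'I_M -> T -> R) (k : nat)
    : T -> R :=
  fun w => k%:R^-1 * \sum_(i < M | (i < k)%N) Y i w.

(* Main.v *)
Require Import Defs.
From mathcomp Require Import all_boot all_order all_algebra.
From mathcomp Require Import all_classical all_reals all_analysis.
From mathcomp Require Import measurable_realfun ring.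

(* Write n = N and m = upsilon N.  The estimator is a weighted sum over the m
   independent samples of a_i Q_H + b_i Q_L, where a_i = 1/n for i < n and 0
   otherwise, and b_i = alpha (a_i - 1/m).  Independent samples contribute no
   cross covariances, so its variance is
     Var[Q_H] sum a_i^2 + 2 Cov[Q_H, Q_L] sum a_i b_i + Var[Q_L] sum b_i^2
       = Var[Q_H] / n + (1/n - 1/m) (2 alpha Cov[Q_H, Q_L] + alpha^2 Var[Q_L]),
   and alpha = - Cov[Q_H, Q_L] / Var[Q_L].  Since sum a_i = 1 and sum b_i = 0,
   its mean is E[Q_H], so the bias comes from the basis truncation only. *)

Set Implicit Arguments.
Unset Strict Implicit.
Unset Printing Implicit Defensive.

Import Order.TTheory GRing.Theory Num.Theory.
Import numFieldNormedType.Exports.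

Local Open Scope classical_set_scope.
Local Open Scope ring_scope.

(** * Measurability of linear maps between Borel spaces of column vectors *)

Section borel_matrices.
Context (R : realType).

Lemma mulmx_continuous m n p (A : 'M[R]_(m, n)) :
  continuous (mulmx A : 'M[R]_(n, p) -> 'M[R]_(m, p)).
Proof.
(* A neighbourhood of a matrix contains a product of neighbourhoods [B i j] of its entries. Each
   entry of [A *m y] is continuous in [y], and there are finitely many entries, so all the
   conditions hold together near [x]. *)
move=> x U [B nB sBU].
have cij i j : continuous (fun y : 'M[R]_(n, p) => (A *m y) i j).
  rewrite (_ : (fun _ => _) = (fun y : 'M[R]_(n, p) => \sum_k A i k * y k j)).
    apply: continuous_big => [|k _ y]; first exact: add_continuous.
    apply: (continuousM (s := cst (A i k))); first exact: cst_continuous.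
    exact: coord_continuous.
  by apply/funext => y; rewrite mxE.
have nball : \forall y \near x, forall i j, B i j ((A *m y) i j).
  have FF : Filter (nbhs x) by exact: nbhs_filter.
  apply: (@filter_forall _ _ _ _ FF) => i.
  apply: (@filter_forall _ _ _ _ FF) => j.
  exact: (cij i j x _ (nB i j)).
by apply: (@filterS _ _ (nbhs_filter x) _ _ _ nball) => y By; exact: sBU.
Qed.

Lemma continuous_measurable_borel_cV m n (f : 'cV[R]_m -> 'cV[R]_n) :
  continuous f ->
  measurable_fun setT (f : borel_cV R m -> borel_cV R n).
Proof.
move=> /continuousP cf.
apply: (@measurability _ _ (borel_cV R m) (borel_cV R n) setT f
  (@open 'cV[R]_n) erefl).
by move=> _ [B oB <-]; rewrite setTI; apply: sub_sigma_algebra; exact: cf.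
Qed.

End borel_matrices.

(** * Square-integrable functions: mean squared error, variances and covariances of sums *)

Section square_integrable.
Context d (T : measurableType d) (R : realType) (P : probability T R).
Local Open Scope ereal_scope.

Lemma Lfun2_of_sqr (f : T -> R) : measurable_fun setT f ->
  \int[P]_w ((f w) ^+ 2)%:E < +oo -> f \in Lfun P 2%:E.
Proof.
move=> mf foo; apply/andP; split; first by rewrite inE.
rewrite inE /finite_norm /= unlock /Lnorm poweR_lty//.
by under eq_integral do rewrite /= powR_mulrn// real_normK ?num_real//.
Qed.

Lemma Lfun21 (f : T -> R) : f \in Lfun P 2%:E -> f \in Lfun P 1.
Proof. by apply: Lfun_subset12; exact: fin_num_measure. Qed.

Lemma Lfun2_scale (a : R) (f : T -> R) :
  f \in Lfun P 2%:E -> (a \o* f)%R \in Lfun P 2%:E.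
Proof. by apply: Lfun_scale; rewrite ler1n. Qed.

(** A finite variance says that [f] minus the constant [c] is square integrable. [c] is a real
    number in every case, because [fine] sends infinite values to 0, and adding it back stays in L2
    of a probability. *)
Lemma Lfun2_of_variance (f : T -> R) : measurable_fun setT f ->
  'V_P[f] < +oo -> f \in Lfun P 2%:E.
Proof.
move=> mf; rewrite /variance unlock unlock => foo.
set c := fine _ in foo.
have -> : f = ((f \- cst c) \+ cst c)%R by apply/funext => x /=; rewrite subrK.
rewrite rpredD ?lee1n//= => ?; last exact: Lfun_cst.
apply: Lfun2_of_sqr; first by apply: measurable_funB.
by move: foo; apply: le_lt_trans; under eq_integral do rewrite expr2.
Qed.

(** A shift by [c] leaves the variance unchanged, so this is Var[g] = E[g^2] - E[g]^2 for g = f - c.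
    Finiteness of E[g] allows E[g]^2 to be moved across in the extended reals. *)
Lemma mseE (f : T -> R) (c : R) : f \in Lfun P 2%:E ->
  mse P f c = 'V_P[f] + ('E_P[f] - c%:E) ^+ 2.
Proof.
move=> f2; have f1 := Lfun21 f2.
have E1 := expectation_fin_num f1.
have c2 : cst c \in Lfun P 2%:E by exact: Lfun_cst.
have g2 : (f \- cst c)%R \in Lfun P 2%:E by rewrite rpredB// lee1n.
have G1 := expectation_fin_num (Lfun21 g2).
rewrite -(varianceB_cst_r c f2) varianceE//.
have -> : 'E_P[f] - c%:E = 'E_P[f \- cst c].
  by rewrite expectationB ?expectation_cst//; exact: Lfun21.
by rewrite subeK// fin_numX.
Qed.

Lemma Lfun2_sum (I : Type) (s : seq I) (Z : I -> T -> R) :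
  (forall i, Z i \in Lfun P 2%:E) -> (\sum_(i <- s) Z i)%R \in Lfun P 2%:E.
Proof. by move=> Z2; rewrite rpred_sum ?lee1n. Qed.

Lemma covariance_sumr (I : Type) (s : seq I) (Z : I -> T -> R) (X : T -> R) :
  X \in Lfun P 2%:E -> (forall i, Z i \in Lfun P 2%:E) ->
  covariance P X (\sum_(i <- s) Z i)%R = \sum_(i <- s) covariance P X (Z i).
Proof.
move=> X2 Z2; elim: s => [|i s IH].
  by rewrite !big_nil (_ : 0%R = cst 0%R)// covariance_cst_r.
rewrite !big_cons covarianceDr//; first by rewrite IH.
exact: Lfun2_sum.
Qed.

Lemma variance_sum_uncorrelated (I : eqType) (s : seq I) (Z : I -> T -> R) :
  uniq s -> (forall i, Z i \in Lfun P 2%:E) ->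
  (forall i j, i != j -> covariance P (Z i) (Z j) = 0) ->
  'V_P[(\sum_(i <- s) Z i)%R] = \sum_(i <- s) 'V_P[Z i].
Proof.
move=> + Z2 Z0; elim: s => [|i s IH] /=.
  by rewrite !big_nil (_ : 0%R = cst 0%R)// variance_cst.
move=> /andP[iNs us]; rewrite !big_cons varianceD//; last exact: Lfun2_sum.
rewrite covariance_sumr// IH//.
(* The cross term vanishes: by [uniq], the head [i] differs from every index [j] of the tail. *)
rewrite [X in 2 * X]big_seq [X in 2 * X]big1 => [|j js].
  by rewrite mule0 adde0.
by apply: Z0; apply: contraNneq iNs => ->.
Qed.

Lemma variance_lin (a b : R) (X Y : T -> R) :
  X \in Lfun P 2%:E -> Y \in Lfun P 2%:E ->
  'V_P[(fun w => a * X w + b * Y w)%R] =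
  (a ^+ 2 * fine 'V_P[X] + 2 * (a * b) * fine (covariance P X Y) +
   b ^+ 2 * fine 'V_P[Y])%:E.
Proof.
move=> X2 Y2.
have X1 := Lfun21 X2; have Y1 := Lfun21 Y2.
have XY1 := Lfun2_mul_Lfun1 X2 Y2.
rewrite (_ : (fun _ => _) = (a \o* X) \+ (b \o* Y))%R; last first.
  by apply/funext => w /=; congr (_ + _)%R; rewrite mulrC.
have aX2 := Lfun2_scale a X2; have bY2 := Lfun2_scale b Y2.
rewrite (varianceD aX2 bY2) (varianceZ _ X2) (varianceZ _ Y2).
rewrite (covarianceZl _ X1 (Lfun21 bY2) (Lfun2_mul_Lfun1 X2 bY2)).
rewrite (covarianceZr _ X1 Y1 XY1).
move: (variance_fin_num X2) (variance_fin_num Y2) (covariance_fin_num X1 Y1 XY1).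
case: 'V_P[X] => [VX| |] // _; case: 'V_P[Y] => [VY| |] // _.
case: (covariance P X Y) => [C| |] // _ /=.
by rewrite -!EFinM -!EFinD; congr EFin; ring.
Qed.

End square_integrable.

(** * Equality in law, and vanishing covariance under independence *)

Section transfer.
Context d (T : measurableType d) (R : realType) (P : probability T R).
Context d' (E : measurableType d').
Local Open Scope ereal_scope.

(** The positive and negative parts of [f] are transferred separately, since the change of variables
    for nonnegative functions holds even for infinite integrals. The result can therefore serve to
    establish integrability. *)
Lemma expectation_identically_distributed (X Y : {RV P >-> E}) (f : E -> R) :
  identically_distributed X Y -> measurable_fun setT f ->
  'E_P[f \o X] = 'E_P[f \o Y].
Proof.
move=> XY mf; rewrite unlock.
have pushE (g : E -> \bar R) : measurable_fun setT g -> (forall x, 0 <= g x) ->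
    \int[P]_w g (X w) = \int[P]_w g (Y w).
  move=> mg g0.
  rewrite -[LHS](ge0_integral_distribution X mg g0).
  rewrite -[RHS](ge0_integral_distribution Y mg g0).
  by apply: eq_measure_integral => A mA _; exact: XY.
have mF : measurable_fun setT (EFin \o f) by exact/measurable_EFinP.
rewrite [LHS](integralE _ _ ((EFin \o f) \o X)).
rewrite [RHS](integralE _ _ ((EFin \o f) \o Y)).
rewrite (funepos_comp _ X) (funepos_comp _ Y).
rewrite (funeneg_comp _ X) (funeneg_comp _ Y).
congr (_ - _).
- exact: (pushE _ (measurable_funepos mF) (@funepos_ge0 _ _ _)).
- exact: (pushE _ (measurable_funeneg mF) (@funeneg_ge0 _ _ _)).
Qed.

Lemma Lfun2_identically_distributed (X Y : {RV P >-> E}) (f : E -> R) :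
  identically_distributed X Y -> measurable_fun setT f ->
  f \o Y \in Lfun P 2%:E -> f \o X \in Lfun P 2%:E.
Proof.
move=> XY mf fY; apply: Lfun2_of_sqr; first exact: measurableT_comp.
have := expectation_identically_distributed XY (measurable_funX 2 mf).
rewrite unlock /= => ->.
exact: (integrable_lty _ (Lfun2_integrable_sqr fY)).
Qed.

Lemma covariance_identically_distributed (X Y : {RV P >-> E}) (f g : E -> R) :
  identically_distributed X Y ->
  measurable_fun setT f -> measurable_fun setT g ->
  covariance P (f \o X) (g \o X) = covariance P (f \o Y) (g \o Y).
Proof.
move=> XY mf mg; rewrite unlock !(expectation_identically_distributed XY)//.
(* The centring constants now agree on both sides, so each covariance is the expectation of one
   fixed function of the sample. *)
set a := fine _; set b := fine _.
apply: (expectation_identically_distributed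
  (f := ((f \- cst a) \* (g \- cst b))%R) XY).
by apply: measurable_funM; exact: measurable_funB.
Qed.

(** The joint law of the pair agrees with the product of the marginal laws on rectangles, hence
    everywhere; Fubini then factors the expectation of the product. *)
Lemma covariance_independent (I : finType) (X : I -> {RV P >-> E})
    (i j : I) (f g : E -> R) :
  mutually_independent P (fun i w => X i w) -> i != j ->
  measurable_fun setT f -> measurable_fun setT g ->
  f \o X i \in Lfun P 2%:E -> g \o X j \in Lfun P 2%:E ->
  covariance P (f \o X i) (g \o X j) = 0.
Proof.
move=> indep ij mf mg f2 g2.
have f1 := Lfun21 f2; have g1 := Lfun21 g2.
have fg1 := Lfun2_mul_Lfun1 f2 g2.
rewrite covarianceE//.
suff -> : 'E_P[(f \o X i) * (g \o X j)] = 'E_P[f \o X i] * 'E_P[g \o X j].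
  by rewrite subee// fin_numM// expectation_fin_num.
pose W w := (X i w, X j w).
have mW : measurable_fun setT W by exact: measurable_fun_pair.
pose mWm := isMeasurableFun.Build _ _ _ _ _ mW.
pose WW : {RV P >-> (E * E)%type} := MeasurableFun.Pack (MeasurableFun.Class mWm).
have joint A B : measurable A -> measurable B ->
    distribution P WW (A `*` B) = distribution P (X i) A * distribution P (X j) B.
  move=> mA mB.
  (* The product rule for the subfamily {i, j}: as i and j differ, the test sets are [A] at i and
     [B] at j. *)
  have /= := indep [set i; j]%SET (fun k => if k == i then A else B).
  rewrite big_setU1 ?inE// big_set1 eqxx eq_sym (negbTE ij) => <-; last first.
    by move=> k; case: ifP.
  rewrite /distribution /pushforward; congr (P _); apply/seteqP; split.
  - move=> w [/= Aw Bw] k /=; rewrite !inE => /orP[] /eqP ->.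
      by rewrite eqxx.
    by rewrite eq_sym (negbTE ij).
  - move=> w Hw; split => /=.
    + by have := Hw i; rewrite /= !inE eqxx /=; exact.
    + by have := Hw j; rewrite /= !inE eqxx orbT eq_sym (negbTE ij); exact.
have mF : measurable_fun setT (fun z : E * E => (f z.1 * g z.2)%:E).
  apply/measurable_EFinP; apply: measurable_funM.
  - exact: measurableT_comp mf measurable_fst.
  - exact: measurableT_comp mg measurable_snd.
have iFW : P.-integrable setT ((fun z : E * E => (f z.1 * g z.2)%:E) \o WW).
  exact/Lfun1_integrable.
have ifX : (distribution P (X i)).-integrable setT (EFin \o f).
  apply: integrable_pushforward => //; first exact/measurable_EFinP.
  exact/Lfun1_integrable.
have igX : (distribution P (X j)).-integrable setT (EFin \o g).
  apply: integrable_pushforward => //; first exact/measurable_EFinP.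
  exact/Lfun1_integrable.
(* Fubini needs integrability under the product law; it is inherited from the joint law of [WW],
   where it is L1 membership of the product. *)
have iF : (distribution P (X i) \x distribution P (X j)).-integrable setT
    (fun z : E * E => (f z.1 * g z.2)%:E).
  apply/integrableP; split=> //.
  rewrite (eq_measure_integral (distribution P WW)); last first.
    by move=> A mA _; exact: product_measure_unique.
  have /integrableP[] // :=
    integrable_pushforward (D := setT) mW mF iFW measurableT.
rewrite unlock.
rewrite -[LHS](integral_distribution mF iFW).
rewrite (eq_measure_integral (distribution P (X i) \x distribution P (X j)));
  last by move=> A mA _; apply/esym; exact: product_measure_unique.
rewrite -integral12_prod_meas1//= /fubini_F /=.
have EX k (h : E -> R) : measurable_fun setT h -> h \o X k \in Lfun P 1 ->
    \int[distribution P (X k)]_x (h x)%:E = \int[P]_w (h (X k w))%:E.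
  move=> mh h1; rewrite -(@integral_distribution _ _ _ _ _ P (X k) (EFin \o h))//.
  - exact/measurable_EFinP.
  - exact/Lfun1_integrable.
have gfin : \int[P]_w (g (X j w))%:E \is a fin_num.
  by have := expectation_fin_num g1; rewrite unlock.
(* The inner integral is f(x) E[g]; writing the finite E[g] as a real lets it leave the outer
   integral as a scalar. *)
under eq_integral => x _.
  under eq_integral do rewrite EFinM.
  rewrite integralZl// EX// -(fineK gfin).
  over.
by rewrite /= integralZr// EX// fineK.
Qed.

End transfer.

(** * Mean and variance of weighted sums over independent, identically distributed samples *)

Section weighted_sums.
Context d (T : measurableType d) (R : realType) (P : probability T R).
Context d' (E : measurableType d') (I : finType).
Variables (X : I -> {RV P >-> E}) (X0 : {RV P >-> E}) (f g : E -> R).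
Hypotheses (indepX : mutually_independent P (fun i w => X i w))
  (idX : forall i, identically_distributed (X i) X0)
  (mf : measurable_fun setT f) (mg : measurable_fun setT g)
  (f2 : f \o X0 \in Lfun P 2%:E) (g2 : g \o X0 \in Lfun P 2%:E).

Let lin (a b : R) (x : E) : R := a * f x + b * g x.

Let measurable_lin a b : measurable_fun setT (lin a b).
Proof. by apply: measurable_funD; exact: measurable_funM. Qed.

Let Lfun2_lin a b (Y : {RV P >-> E}) : f \o Y \in Lfun P 2%:E ->
  g \o Y \in Lfun P 2%:E -> lin a b \o Y \in Lfun P 2%:E.
Proof.
move=> fY gY.
rewrite (_ : _ \o _ = (a \o* (f \o Y)) \+ (b \o* (g \o Y)))%R; last first.
  by apply/funext => w /=; congr (_ + _); rewrite mulrC.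
by rewrite rpredD ?lee1n//= => ?; rewrite Lfun_scale ?ler1n.
Qed.

Variables a b : I -> R.

Let Z i := lin (a i) (b i) \o X i.

Let fX i : f \o X i \in Lfun P 2%:E.
Proof. exact: Lfun2_identically_distributed. Qed.

Let gX i : g \o X i \in Lfun P 2%:E.
Proof. exact: Lfun2_identically_distributed. Qed.

Let Z2 i : Z i \in Lfun P 2%:E.
Proof. exact: Lfun2_lin. Qed.

Let sumZE : (fun w => \sum_i (a i * f (X i w) + b i * g (X i w))) =
  \sum_i Z i.
Proof. by apply/funext => w; rewrite fct_sumE. Qed.

Lemma Lfun2_weighted_sum :
  (fun w => \sum_i (a i * f (X i w) + b i * g (X i w))) \in Lfun P 2%:E.
Proof. by rewrite sumZE; exact: Lfun2_sum. Qed.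

Lemma expectation_weighted_sum :
  'E_P[fun w => (\sum_i (a i * f (X i w) + b i * g (X i w)))%R]%E =
  ((\sum_i a i) * fine 'E_P[f \o X0]%E
   + (\sum_i b i) * fine 'E_P[g \o X0]%E)%:E.
Proof.
rewrite sumZE.
have -> : (\sum_i Z i = \sum_(Y <- [seq Z i | i <- index_enum I]) Y)%R.
  by rewrite big_map.
rewrite expectation_sum; last by move=> _ /mapP[i _ ->]; exact: Lfun21.
rewrite big_map mulr_suml mulr_suml -big_split -sumEFin.
apply: eq_bigr => i _.
rewrite (expectation_identically_distributed (idX i))//.
rewrite (_ : _ \o _ = (a i \o* (f \o X0)) \+ (b i \o* (g \o X0)))%R; last first.
  by apply/funext => w /=; congr (_ + _); rewrite mulrC.
rewrite expectationD ?Lfun_scale ?Lfun21// !expectationZl ?Lfun21//.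
by rewrite EFinD !EFinM !fineK// expectation_fin_num// Lfun21.
Qed.

Lemma variance_weighted_sum :
  'V_P[fun w => (\sum_i (a i * f (X i w) + b i * g (X i w)))%R]%E =
  ((\sum_i a i ^+ 2) * fine 'V_P[f \o X0]%E
   + 2 * (\sum_i a i * b i) * fine (covariance P (f \o X0) (g \o X0))
   + (\sum_i b i ^+ 2) * fine 'V_P[g \o X0]%E)%:E.
Proof.
rewrite sumZE variance_sum_uncorrelated//; last 2 first.
- exact: index_enum_uniq.
- move=> i j ij.
  by apply: (covariance_independent indepX ij) => //; exact: Lfun2_lin.
rewrite mulr_sumr !mulr_suml -!big_split -sumEFin.
apply: eq_bigr => i _.
(* Read as the covariance of [Z i] with itself, the variance passes from [X i] to [X0]. *)
rewrite /variance (covariance_identically_distributed (idX i))//.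
exact: variance_lin.
Qed.

End weighted_sums.

(** * The weights of the estimator and its error decomposition *)

Lemma sum_ord_prefix (R : pzSemiRingType) (M k : nat) (c : R) : (k <= M)%N ->
  \sum_(i < M) (if (i < k)%N then c else 0) = c *+ k.
Proof.
move=> kM; rewrite -big_mkcond /= -(big_ord_widen _ (fun=> c) kM).
by rewrite sumr_const card_ord.
Qed.

Theorem proposition4p2 (R : realType) (d : measure_display)
    (T : measurableType d) (P : probability T R)
    (dH dL rH rL : nat)
    (rH_gt0 : (1 <= rH)%N) (rH_le : (rH <= dH)%N)
    (rL_gt0 : (1 <= rL)%N) (rL_le : (rL <= dL)%N)
    (AH : 'M[R]_dH) (AL : 'M[R]_dL)
    (AH_orth : AH *m AH^T = 1%:M) (AL_orth : AL *m AL^T = 1%:M)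
    (QH : {mfun borel_cV R dH >-> R}) (QL : {mfun borel_cV R dL >-> R})
    (xiH : {RV P >-> borel_cV R dH})
    (etas : {RV P >-> borel_cV R (maxn rH rL)})
    (xiH_gauss : standard_gaussian xiH)
    (etas_gauss : standard_gaussian etas)
    (N M : nat) (upsilon : R)
    (N_ge1 : (1 <= N)%N) (upsilon_gt1 : 1 < upsilon)
    (upsilonN : upsilon * N%:R = M%:R)
    (eta : 'I_M -> {RV P >-> borel_cV R (maxn rH rL)})
    (eta_indep : mutually_independent P (fun (i : 'I_M) (w : T) => eta i w))
    (eta_id : forall i, identically_distributed (eta i) etas) :
  let calAHT := truncated_basis rH_le (leq_maxl rH rL) AH in
  let calALT := truncated_basis rL_le (leq_maxr rH rL) AL in
  let QHr (x : 'cV[R]_(maxn rH rL)) : R := QH (calAHT *m x) in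
  let QLr (x : 'cV[R]_(maxn rH rL)) : R := QL (calALT *m x) in
  let QH_xi : T -> R := fun w => QH (xiH w) in
  let QH_eta : T -> R := fun w => QHr (etas w) in
  let QL_eta : T -> R := fun w => QLr (etas w) in
  let QH_hat : T -> R := mean_first (fun i w => QHr (eta i w)) N in
  let QL_hat : T -> R := mean_first (fun i w => QLr (eta i w)) N in
  let muL_hat : T -> R := mean_first (fun i w => QLr (eta i w)) M in
  let alpha : R := - pearson_corr P QH_eta QL_eta *
    (Num.sqrt (fine 'V_P[QH_eta]%E) / Num.sqrt (fine 'V_P[QL_eta]%E)) in
  let Q_MFAB : T -> R := fun w => QH_hat w + alpha * (QL_hat w - muL_hat w) in
  let rho2 : R := fine (covariance P QH_eta QL_eta) ^+ 2 /
    (fine 'V_P[QH_eta]%E * fine 'V_P[QL_eta]%E) in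
  let sigma2 : \bar R :=
    ('V_P[QH_hat] * (1 - (upsilon - 1) / upsilon * rho2)%R%:E)%E in
  let delta2 : \bar R := (('E_P[QH_eta] - 'E_P[QH_xi]) ^+ 2)%E in
  P.-integrable setT (EFin \o QH_xi) ->
  (0 < 'V_P[QH_eta] < +oo)%E ->
  (0 < 'V_P[QL_eta] < +oo)%E ->
  [/\ mse P Q_MFAB (fine 'E_P[QH_xi]%E) =
        ('V_P[Q_MFAB] + ('E_P[QH_eta] - 'E_P[QH_xi]) ^+ 2)%E,
      ('V_P[Q_MFAB] + ('E_P[QH_eta] - 'E_P[QH_xi]) ^+ 2 = sigma2 + delta2)%E &
      (('E_P[Q_MFAB] - 'E_P[QH_xi]) ^+ 2 = delta2)%E].
Proof.
move=> calAHT calALT QHr QLr QH_xi QH_eta QL_eta QH_hat QL_hat muL_hat alpha.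
move=> Q_MFAB rho2 sigma2 delta2 xi_int /andP[VH0 VHoo] /andP[VL0 VLoo].
have mQHr : measurable_fun setT (QHr : borel_cV R (maxn rH rL) -> R).
  apply: (measurableT_comp (f := QH)) => //.
  exact: (continuous_measurable_borel_cV (@mulmx_continuous R _ _ 1 calAHT)).
have mQLr : measurable_fun setT (QLr : borel_cV R (maxn rH rL) -> R).
  apply: (measurableT_comp (f := QL)) => //.
  exact: (continuous_measurable_borel_cV (@mulmx_continuous R _ _ 1 calALT)).
have QH2 : QH_eta \in Lfun P 2%:E.
  by apply: Lfun2_of_variance => //; exact: measurableT_comp.
have QL2 : QL_eta \in Lfun P 2%:E.
  by apply: Lfun2_of_variance => //; exact: measurableT_comp.
have n0 : 0 < N%:R :> R by rewrite ltr0n.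
have NM : (N <= M)%N.
  by rewrite -(ler_nat R) -upsilonN ler_peMl// ltW.
pose a (i : 'I_M) : R := if (i < N)%N then N%:R^-1 else 0.
pose b (i : 'I_M) : R := alpha * (a i - M%:R^-1).
have sum_a : \sum_i a i = 1.
  by rewrite sum_ord_prefix// -[LHS]mulr_natr mulVf ?gt_eqF.
have m0 : 0 < M%:R :> R by rewrite -upsilonN mulr_gt0// (lt_trans ltr01).
have sum_M (c : R) : \sum_(i < M) c = c * M%:R.
  by rewrite sumr_const card_ord mulr_natr.
have sum_a2 : \sum_i a i ^+ 2 = N%:R^-1.
  under eq_bigr => i _ do rewrite /a (fun_if (fun x => x ^+ 2)) expr0n /=.
  by rewrite sum_ord_prefix// -[LHS]mulr_natr expr2 -mulrA mulVf ?mulr1 ?gt_eqF.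
have sum_b : \sum_i b i = 0.
  rewrite -mulr_sumr big_split /= sum_a sum_M mulNr mulVf ?gt_eqF//.
  by rewrite subrr mulr0.
(* Expanding one factor [b i] reduces this sum to those of [a i ^+ 2] and [a i]. The same expansion
   in [sum_b2] leaves [sum_ab] and the vanishing sum of [b i]. *)
have sum_ab : \sum_i a i * b i = alpha * (N%:R^-1 - M%:R^-1).
  under eq_bigr => i _.
    rewrite (_ : _ * _ = alpha * a i ^+ 2 - alpha / M%:R * a i); last first.
      by rewrite /b; ring.
    over.
  rewrite big_split /= sumrN -!mulr_sumr sum_a sum_a2; ring.
have sum_b2 : \sum_i b i ^+ 2 = alpha ^+ 2 * (N%:R^-1 - M%:R^-1).
  under eq_bigr => i _.
    rewrite (_ : _ ^+ 2 = alpha * (a i * b i) - alpha / M%:R * b i); last first.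
      by rewrite expr2 {1}/b; ring.
    over.
  rewrite big_split /= sumrN -mulr_sumr sum_ab -mulr_sumr sum_b; ring.
(* Zero weights on [QLr] put the high-fidelity mean in the same form as the estimator, so one
   variance formula covers both. *)
have QH_hatE : QH_hat = fun w =>
    \sum_i (a i * QHr (eta i w) + 0 * QLr (eta i w)).
  apply/funext => w; rewrite /QH_hat /mean_first big_mkcond mulr_sumr.
  apply: eq_bigr => i _; rewrite mul0r addr0 /a.
  by case: ifP; rewrite ?mul0r ?mulr0.
have Q_MFABE : Q_MFAB = fun w =>
    \sum_i (a i * QHr (eta i w) + b i * QLr (eta i w)).
  apply/funext => w; rewrite /Q_MFAB QH_hatE /QL_hat /muL_hat /mean_first.
  rewrite [X in _ * (_ * X - _)]big_mkcond /=.
  (* In the mean over all samples the guard [i < M] always holds. *)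
  rewrite [X in _ * (_ - _ * X)](eq_bigl xpredT) => [|i]; last by rewrite ltn_ord.
  rewrite !mulr_sumr -sumrB mulr_sumr -big_split /=; apply: eq_bigr => i _.
  rewrite /b /a; case: ifP => _; ring.
have E_MFAB : 'E_P[Q_MFAB]%E = 'E_P[QH_eta]%E.
  rewrite Q_MFABE (expectation_weighted_sum eta_id)// sum_a sum_b.
  by rewrite mul1r mul0r addr0 fineK// expectation_fin_num// Lfun21.
have MFAB2 : Q_MFAB \in Lfun P 2%:E.
  by rewrite Q_MFABE; exact: Lfun2_weighted_sum.
have xiK : (fine 'E_P[QH_xi]%E)%:E = 'E_P[QH_xi]%E.
  by rewrite fineK// expectation_fin_num//; exact/Lfun1_integrable.
split.
- by rewrite mseE// xiK E_MFAB.
- congr (_ + _)%E; rewrite /sigma2 Q_MFABE QH_hatE.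
  rewrite !(variance_weighted_sum eta_indep eta_id)//.
  have VHE : 'V_P[QH_eta]%E = (fine 'V_P[QH_eta]%E)%:E.
    by rewrite fineK// variance_fin_num.
  have VLE : 'V_P[QL_eta]%E = (fine 'V_P[QL_eta]%E)%:E.
    by rewrite fineK// variance_fin_num.
  rewrite -EFinM; congr EFin.
  rewrite sum_a2 sum_ab sum_b2 [\sum_i a i * 0]big1 => [|i _]; last first.
    by rewrite mulr0.
  rewrite [\sum_i 0 ^+ 2]big1 => [|i _]; last by rewrite expr0n.
  rewrite -/QH_eta -/QL_eta /rho2 /alpha /pearson_corr.
  move: VH0 VL0; rewrite VHE VLE !lte_fin.
  set C := fine (covariance _ _ _); set VH := fine 'V_P[QH_eta]%E.
  set VL := fine 'V_P[QL_eta]%E => VH0 VL0.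
  (* In [alpha] the factor sqrt VH cancels and the two factors sqrt VL multiply to VL, so no root
     remains. *)
  have -> : - (C / (Num.sqrt VH * Num.sqrt VL)) * (Num.sqrt VH / Num.sqrt VL) =
      - C / VL.
    rewrite -[in RHS](sqr_sqrtr (ltW VL0)).
    by field; rewrite ?sqrtr_eq0 -?ltNge ?VH0 ?VL0.
  (* A rational identity remains: 1/N - 1/M = (upsilon - 1) / (upsilon N), and 2 alpha C + alpha^2
     VL = - C^2 / VL = - rho2 VH. *)
  rewrite -upsilonN /=; field.
  by rewrite !gt_eqF// (lt_trans ltr01).
- by rewrite E_MFAB.
Qed.
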